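(* Let $D>1$, $C_0,C_1,C_2\ge1$ and $p>D$. There exists a constant $C>0$, depending only on $p,D,C_0,C_1,C_2$, such that, for every connected locally finite weighted graph $(V,\omega,\mu)$ satisfying conditions (G1)–(G3) listed in the context with the constants $D,C_0,C_1,C_2$, and for every nonempty finite subset $\Omega\subset V$, $$\mathcal{R}_p(\Omega)\le C\, r_\Omega^{\,p-D}.$$
   Context: A weighted graph is a triple $(V,\omega,\mu)$ where $V$ is a countably infinite set, $\mu:V\to(0,\infty)$, and $\omega:V\times V\to[0,\infty)$ satisfies $\omega_{xy}=\omega_{yx}$ and $\omega_{xx}=0$. Write $x\sim y$ if $\omega_{xy}>0$, and $\deg(x)=\#\{y\in V:y\sim x\}$. The graph is locally finite if $\deg(x)<\infty$ for all $x$, and connected if any two vertices are joined by a finite path $x=x_0\sim x_1\sim\cdots\sim x_m=y$ (of length $m$). The graph distance $d(x,y)$ is the minimal length of a path from $x$ to $y$; $B(x,R)=\{y\in V:d(x,y)\le R\}$ for real $R\ge0$; $\mu(A)=\sum_{x\in A}\mu(x)$ for finite $A\subset V$. Conditions: (G1) $C_0^{-1}\le\mu(x)\le C_0$ for all $x\in V$; $C_0^{-1}\le\omega_{xy}\le C_0$ whenever $x\sim y$; $\deg(x)\le C_0$ for all $x\in V$. (G2) $C_1^{-1}R^D\le\mu(B(x,R))\le C_1R^D$ for all $x\in V$ and all real $R\ge1$. (G3) For every $x_0\in V$, every $R\ge1$ and every $A\subset B(x_0,R)$, $$\min\{\mu(A),\mu(B(x_0,R)\setminus A)\}\le C_2R\sum_{\substack{x\in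 A,\ y\in B(x_0,R)\setminus A\\ y\sim x}}\omega_{xy}.$$ For a nonempty finite $\Omega\subset V$: $X_V(\Omega)=\{u:V\to\mathbb{R}:u=0\text{ in }V\setminus\Omega\}$; $E_p(u)=\frac12\sum_{x,y\in V}\omega_{xy}|u(y)-u(x)|^p$; $\operatorname{Cap}_p(x,\Omega)=\inf\{E_p(\varphi):\varphi\in X_V(\Omega),\varphi(x)=1\}$ for $x\in\Omega$ (which lies in $(0,\infty)$); the capacitary radius is $\mathcal{R}_p(\Omega)=\max_{x\in\Omega}\operatorname{Cap}_p(x,\Omega)^{-1}$; the inner radius is $r_\Omega=\sup_{x\in\Omega}d(x,V\setminus\Omega)$, where $d(x,V\setminus\Omega)=\inf_{y\in V\setminus\Omega}d(x,y)$. *)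

(* Defs.v *)
From HB Require Import structures.
From mathcomp Require Import all_boot all_order all_algebra finmap.
From mathcomp Require Import all_classical all_reals all_analysis.

Set Implicit Arguments.
Unset Strict Implicit.
Unset Printing Implicit Defensive.

Import Order.TTheory GRing.Theory Num.Theory.

Local Open Scope classical_set_scope.
Local Open Scope ring_scope.

Record weighted_graph (R : realType) := WeightedGraph {
  vertex :> countType;
  vertex_infinite : infinite_set [set: vertex];
  weight : vertex -> vertex -> R;
  weight_ge0 : forall x y, 0 <= weight x y;
  weightC : forall x y, weight x y = weight y x;
  weightxx : forall x, weight x x = 0;
  vmeasure : vertex -> R;
  vmeasure_gt0 : forall x, 0 < vmeasure x
}.

Section WeightedGraph.
Context {R : realType} {G : weighted_graph R}.
Implicit Types (x y : G) (A : set G) (Omega : {fset G}).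

Definition adj : rel G := fun x y => 0 < weight x y.

Definition neighbours x : set G := [set y | adj y x].

(* [fset_set] is empty on infinite sets, so [deg] is the number of neighbours
   only when the graph is locally finite. *)
Definition deg x : nat := #|` fset_set (neighbours x)|.

(* [x :: s] lists the vertices of a path, whose length is thus [size s]. *)
Definition path_between x y (s : seq G) : Prop := path adj x s /\ last x s = y.

(* +oo when no path joins [x] to [y]. *)
Definition gdist x y : \bar R :=
  ereal_inf [set (size s)%:R%:E | s in path_between x y].

Definition gball x (r : R) : set G := [set y | (gdist x y <= r%:E)%E].

(* Sums with [\in] are 0 when infinitely many terms are nonzero; below they are
   only taken over finite sets (balls of a locally finite graph). *)
Definition vol A : R := \sum_(x \in A) vmeasure x.

Definition boundary_weight A B : R :=
  \sum_(x \in A) \sum_(y \in B `&` neighbours x) weight x y.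

Definition XV Omega : set (G -> R) :=
  [set u | forall x, x \notin Omega -> u x = 0].

Definition energy (p : R) (u : G -> R) : \bar R :=
  ((2^-1)%:E * \esum_(z in [set: G * G])
     (weight z.1 z.2 * `|u z.2 - u z.1| `^ p)%:E)%E.

Definition capacity (p : R) x Omega : \bar R :=
  ereal_inf [set energy p phi | phi in XV Omega `&` [set phi | phi x = 1]].

(* The inverse is that of [\bar R], for which [0^-1 = +oo]. *)
Definition capacitary_radius (p : R) Omega : \bar R :=
  \big[maxe/-oo%E]_(x <- Omega) ((capacity p x Omega)^-1)%E.

Definition dist_compl x Omega : \bar R :=
  ereal_inf [set gdist x y | y in [set y | y \notin Omega]].

Definition inner_radius Omega : \bar R :=
  ereal_sup [set dist_compl x Omega | x in [set` Omega]].

End WeightedGraph.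

Section Conditions.
Context {R : realType}.
Variable G : weighted_graph R.

Definition locally_finite : Prop := forall x : G, finite_set (neighbours x).

Definition graph_connected : Prop :=
  forall x y : G, exists s, path_between x y s.

Definition cond_bounded (C0 : R) : Prop :=
  [/\ forall x : G, C0^-1 <= vmeasure x <= C0,
      forall x y : G, adj x y -> C0^-1 <= weight x y <= C0 &
      forall x : G, (deg x)%:R <= C0].

Definition cond_volume (D C1 : R) : Prop :=
  forall (x : G) (r : R), 1 <= r ->
    C1^-1 * r `^ D <= vol (gball x r) <= C1 * r `^ D.

Definition cond_isoperimetric (C2 : R) : Prop :=
  forall (x0 : G) (r : R) (A : set G), 1 <= r -> A `<=` gball x0 r ->
    Num.min (vol A) (vol (gball x0 r `\` A)) <=
    C2 * r * boundary_weight A (gball x0 r `\` A).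

End Conditions.

(* Main.v *)
Require Import Defs.
From HB Require Import structures.
From mathcomp Require Import all_boot all_order all_algebra finmap.
From mathcomp Require Import all_classical all_reals all_analysis.
From mathcomp Require Import ring lra.

Set Implicit Arguments.
Unset Strict Implicit.
Unset Printing Implicit Defensive.

Import Order.TTheory GRing.Theory Num.Theory.

Local Open Scope fset_scope.
Local Open Scope ring_scope.

(** Since p > D, the result is an instance of a Morrey inequality.  Let [n] be
the length of a shortest path from [x] in [Omega] to a vertex [y] outside
[Omega], so that [n] is at most the inner radius.  A competitor [phi] for the
capacity of [x] satisfies [phi x = 1] and [phi y = 0], and the Morrey inequality
(lemma [morrey_inequality])

  |phi x - phi y|^p <= C n^(p - D) E_p(phi)

bounds its energy below by [(C n^(p - D))^-1]; inverting the infimum over [phi]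
gives the theorem.

The Morrey inequality is proved by chaining balls of dyadic radii.  On a ball
[B] of radius [r], slicing [f] into its superlevel sets turns the isoperimetric
condition into an L^1 Poincare inequality around a median [c] of [f]
(lemmas [coarea_inequality] and [median_poincare]):

  sum_B |f - c| mu <= C2 r sum_(B x B) w |f y - f z|.

To pass from the gradient to the p-energy, Hoelder's inequality is replaced by
the elementary bound [a <= lam + lam^(1 - p) a^p], taken with
[lam = s r^(- D / p)].  With [al = 1 - D / p], this choice gives both resulting
terms the same power of [r] (lemma [ball_oscillation]):

  sum_B |f - c| mu <= K (s + s^(1 - p) E) r^(D + al).

As the volume of a ball of radius [r] is of order [r^D], centers of [f] on
neighbouring balls of comparable radius [r] differ by at most a constant times
[(s + s^(1 - p) E) r^al].  Because [al > 0], the sum over the radii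
[1, 2, 4, ...] up to about [n] is a geometric sum dominated by its last term, so
that |f x - f y| is at most [H n^al (s + s^(1 - p) E)] for every [s > 0]
(lemma [telescope_diff]).  Choosing [s] so that [H n^al s] is half of the left
hand side yields the inequality, as [al * p = p - D]. *)

(** * From isoperimetry to an L1 Poincare inequality on finite sets *)

Lemma seq_has_max (R : realDomainType) (s : seq R) :
  s != [::] -> exists2 v, v \in s & forall u, u \in s -> u <= v.
Proof.
elim: s => // a [|b s] IH _.
  by exists a; rewrite ?mem_head// => u; rewrite inE => /eqP->.
have [//|v vs vmax] := IH.
have [av|va] := leP a v.
- exists v; first by rewrite in_cons vs orbT.
  by move=> u; rewrite in_cons => /predU1P[->//|/vmax].
- exists a; first exact: mem_head.
  move=> u; rewrite in_cons => /predU1P[->//|/vmax uv].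
  exact: le_trans uv (ltW va).
Qed.

Lemma seq_has_min (R : realDomainType) (s : seq R) :
  s != [::] -> exists2 v, v \in s & forall u, u \in s -> v <= u.
Proof.
case: s => // a s _.
have [//|v /mapP[u us ->] vmax] := @seq_has_max _ (map -%R (a :: s)).
exists u => // z zs; rewrite -lerN2; apply: vmax; exact: map_f.
Qed.

(** A layer-cake argument without integration: if [t] is the least positive
value of [f], then [f] is the sum of [Num.max (f - t) 0] and of [t] times the
indicator of its support, and both sides of the inequality split accordingly.
The second summand is controlled by the hypothesis at level [0], the first one
by induction on the number of points where the function is positive. *)
Lemma coarea_inequality (R : realFieldType) (T : eqType) (r : seq T)
    (mu : T -> R) (w : T -> T -> R) (K : R) (f : T -> R) :
  0 <= K -> (forall x y, 0 <= w x y) -> (forall x, 0 <= f x) ->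
  (forall t : R, 0 <= t -> \sum_(x <- r | t < f x) mu x <=
     K * \sum_(x <- r | t < f x) \sum_(y <- r | f y <= t) w x y) ->
  \sum_(x <- r) f x * mu x <=
  K * \sum_(x <- r) \sum_(y <- r) w x y * Num.max (f x - f y) 0.
Proof.
move=> K0 w0; have [n] := ubnP (count (fun x => 0 < f x) r).
elim: n f => // n IH f; rewrite ltnS => cn f0 Hf.
have [hasf|nohas] := boolP (has (fun x => 0 < f x) r); last first.
  rewrite big1_seq; last first.
    move=> x /= xr; have /hasPn/(_ _ xr) := nohas.
    by rewrite -leNgt => fx; have /le_anti-> : f x <= 0 <= f x;
      rewrite ?fx ?f0 ?mul0r.
  rewrite mulr_ge0// sumr_ge0// => x _; rewrite sumr_ge0// => y _.
  by rewrite mulr_ge0// le_max lexx orbT.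
have [|t] := @seq_has_min _ [seq v <- map f r | 0 < v].
  by rewrite -has_filter has_map.
rewrite mem_filter => /andP[t0 /mapP[x0 x0r tE]] tmin.
have {}tmin x : x \in r -> 0 < f x -> t <= f x.
  by move=> xr fx; apply: tmin; rewrite mem_filter fx map_f.
(* [g] vanishes where [f] takes the value [t], hence has smaller support. *)
pose g x : R := Num.max (f x - t) 0.
have gE (s : R) x : 0 <= s -> (s < g x) = (s + t < f x).
  by move=> s0; rewrite /g lt_max [s < 0]ltNge s0 orbF ltrBrDr.
have fgE x : x \in r -> f x = g x + (if 0 < f x then t else 0).
  move=> xr; rewrite /g; have [fx|fx] := ltP 0 (f x).
    by rewrite max_l ?subrK// subr_ge0 tmin.
  have -> : f x = 0 by apply/le_anti; rewrite fx f0.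
  by rewrite max_r ?addr0//; lra.
have /IH IHg : (count (fun x => 0 < g x)%R r < n)%N.
  apply: (leq_trans _ cn).
  have -> : count (fun x => 0 < f x) r =
      (count (fun x => (0 < f x)%R && (f x <= t)%R) r + count (fun x => 0 < g x)%R r)%N.
    rewrite -count_predUI [X in _ = (_ + X)%N](_ : _ = 0)%N ?addn0.
      apply: eq_count => x /=; rewrite gE// add0r.
      by case: (leP (f x) t) => [|tx]; rewrite ?andbT ?orbF// (lt_trans t0 tx) orbT.
    apply/eqP; rewrite eqn0Ngt -has_count; apply/hasPn => x _ /=.
    by rewrite gE// add0r [t < _]ltNge; case: (f x <= t); rewrite /= ?andbF.
  rewrite -add1n leq_add2r -has_count; apply/hasP; exists x0 => //=.
  by rewrite -tE t0 lexx.
have g0 x : 0 <= g x by rewrite /g le_max lexx orbT.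
have := IHg g0; have -> : \sum_(x <- r) f x * mu x =
    \sum_(x <- r) g x * mu x + t * \sum_(x <- r | 0 < f x) mu x.
  rewrite mulr_sumr [X in _ + X]big_mkcond -big_split /=.
  rewrite big_seq [RHS]big_seq; apply: eq_bigr => x xr.
  by rewrite [in LHS]fgE// mulrDl; case: ifP; rewrite ?mul0r.
have -> : \sum_(x <- r) \sum_(y <- r) w x y * Num.max (f x - f y) 0 =
    \sum_(x <- r) \sum_(y <- r) w x y * Num.max (g x - g y) 0 +
    t * \sum_(x <- r | 0 < f x) \sum_(y <- r | f y <= 0) w x y.
  rewrite mulr_sumr [X in _ + X]big_mkcond -big_split /=.
  rewrite big_seq [RHS]big_seq; apply: eq_bigr => x xr.
  have gx := g0 x.
  have [fx|fx] := ltP 0 (f x).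
    rewrite mulr_sumr [X in _ + X]big_mkcond -big_split /=.
    rewrite big_seq [RHS]big_seq; apply: eq_bigr => y yr.
    have := fgE _ xr; have := fgE _ yr; rewrite fx; have gy := g0 y.
    have [fy fyE fxE|fy fyE fxE] := ltP 0 (f y).
      by rewrite addr0 fyE fxE; congr (_ * Num.max _ _); ring.
    have gy0 : g y = 0 by apply/le_anti; rewrite gy andbT; lra.
    by rewrite fyE fxE gy0 addr0 !subr0 !max_l//; [ring|lra].
  have gx0 : g x = 0.
    by apply/le_anti; rewrite gx andbT; move: (fgE _ xr); rewrite ltNge fx /=; lra.
  rewrite addr0; apply: eq_bigr => y _; congr (_ * _).
  have fy := f0 y; have gy := g0 y.
  by rewrite [LHS]max_r ?[RHS]max_r//; lra.
rewrite mulrDr => Hg; apply: lerD.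
  apply: Hg => s s0.
  have := Hf (s + t) (addr_ge0 s0 (ltW t0)).
  under eq_bigl do rewrite -gE//; move=> /le_trans; apply.
  rewrite ler_wpM2l//; under eq_bigl do rewrite -gE//.
  rewrite le_eqVlt; apply/predU1P; left; apply: eq_bigr => x _.
  by apply: eq_bigl => y; rewrite leNgt -gE// -leNgt.
by rewrite [leRHS]mulrCA ler_wpM2l ?Hf// ltW.
Qed.

(** The least value [m] of [f] whose strict superlevel set carries at most half
of the mass is a median: the largest value of [f] below [m] fails this property,
so that the strict sublevel set of [m] carries less than half of the mass. *)
Lemma exists_median (R : realDomainType) (T : eqType) (r : seq T)
    (mu : T -> R) (f : T -> R) : r != [::] -> (forall x, 0 <= mu x) ->
  exists m,
    \sum_(x <- r | m < f x) mu x <= \sum_(x <- r | ~~ (m < f x)) mu x /\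
    \sum_(x <- r | f x < m) mu x <= \sum_(x <- r | ~~ (f x < m)) mu x.
Proof.
move=> r0 mu0.
pose good m := \sum_(x <- r | m < f x) mu x <= \sum_(x <- r | ~~ (m < f x)) mu x.
have sum0 (P : pred T) : (forall x, x \in r -> ~~ P x) ->
    \sum_(x <- r | P x) mu x <= \sum_(x <- r | ~~ P x) mu x.
  move=> nP; rewrite big1_seq ?sumr_ge0// => x /andP[Px xr].
  by move: (nP _ xr); rewrite Px.
have mapr0 : map f r != [::] by case: (r) r0.
have [|m] := @seq_has_min _ [seq v <- map f r | good v].
  rewrite -has_filter; have [M Mr Mmax] := seq_has_max mapr0.
  apply/hasP; exists M => //; apply: sum0 => x xr.
  by rewrite -leNgt Mmax// map_f.
rewrite mem_filter => /andP[gm mr] mmin; exists m; split => //.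
have [has_lt|no_lt] := boolP (has (fun v => v < m) (map f r)); last first.
  by apply: sum0 => x xr; apply: (hasPn no_lt); apply: map_f.
have [|v] := @seq_has_max _ [seq v <- map f r | v < m].
  by rewrite -has_filter.
rewrite mem_filter => /andP[vm vr] vmax.
have vE x : x \in r -> (f x < m) = ~~ (v < f x).
  move=> xr; rewrite -leNgt; apply/idP/idP => [fxm|fxv].
    by apply: vmax; rewrite mem_filter fxm map_f.
  exact: le_lt_trans fxv vm.
have /negP : ~~ good v.
  by apply/negP => gv; have := mmin v; rewrite mem_filter gv vr leNgt vm => /(_ isT).
move/negP; rewrite -ltNge => /ltW.
have e1 : \sum_(x <- r | ~~ (v < f x)) mu x = \sum_(x <- r | f x < m) mu x.
  rewrite big_seq_cond [RHS]big_seq_cond; apply: eq_bigl => x.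
  by case: (boolP (x \in r)) => //= /vE->.
have e2 : \sum_(x <- r | v < f x) mu x = \sum_(x <- r | ~~ (f x < m)) mu x.
  rewrite big_seq_cond [RHS]big_seq_cond; apply: eq_bigl => x.
  by case: (boolP (x \in r)) => //= /vE->; rewrite negbK.
by rewrite e1 e2.
Qed.

(** The positive part of [a - m] increases with [a] and its negative part
decreases, so at most one of the two terms is nonzero: splitting a function at [m]
does not increase the total gradient. *)
Lemma posneg_parts_contract (R : realFieldType) (m a b : R) :
  Num.max (Num.max (a - m) 0 - Num.max (b - m) 0) 0 +
  Num.max (Num.max (m - a) 0 - Num.max (m - b) 0) 0 <= `|a - b|.
Proof.
wlog ba : m a b / b <= a.
  move=> H; have [/H//|/ltW ab] := leP b a.
  have := H (- m) (- a) (- b); rewrite lerN2 => /(_ ab).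
  by rewrite !opprK ![- _ + _]addrC (distrC b) [leLHS]addrC.
have le_max0 (x y : R) : x <= y -> Num.max x 0 <= Num.max y 0.
  by move=> xy; rewrite ge_max !le_max xy lexx orbT.
rewrite ger0_norm ?subr_ge0// [Num.max (_ - Num.max (m - b) 0) 0]max_r; last first.
  by rewrite subr_le0 le_max0// lerB.
rewrite addr0 max_l; last by rewrite subr_ge0 le_max0// lerB.
rewrite lerBlDr ge_max; apply/andP; split.
  by rewrite -lerBlDl le_max; apply/orP; left; lra.
by rewrite addr_ge0 ?subr_ge0// le_max lexx orbT.
Qed.

(** The center [c] is a median.  The strict superlevel sets, at levels [t >= 0],
of the positive and of the negative part of [f - c] then carry at most half of
the mass, so they realize the minimum in the isoperimetric hypothesis and
[coarea_inequality] applies to both parts. *)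
Lemma median_poincare (R : realFieldType) (T : eqType) (r : seq T)
    (mu : T -> R) (w : T -> T -> R) (K : R) (f : T -> R) :
  r != [::] -> 0 <= K -> (forall x, 0 <= mu x) -> (forall x y, 0 <= w x y) ->
  (forall P : pred T,
     Num.min (\sum_(x <- r | P x) mu x) (\sum_(x <- r | ~~ P x) mu x) <=
     K * \sum_(x <- r | P x) \sum_(y <- r | ~~ P y) w x y) ->
  exists c, \sum_(x <- r) `|f x - c| * mu x <=
    K * \sum_(x <- r) \sum_(y <- r) w x y * `|f x - f y|.
Proof.
move=> r0 K0 mu0 w0 iso; have [m [m1 m2]] := exists_median f r0 mu0; exists m.
have maxP (a : R) : Num.max a 0 = a /\ 0 <= a \/ Num.max a 0 = 0 /\ a <= 0.
  by case: (leP a 0); [right|move/ltW; left].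
pose u x : R := Num.max (f x - m) 0; pose v x : R := Num.max (m - f x) 0.
have uP x : u x = f x - m /\ 0 <= f x - m \/ u x = 0 /\ f x - m <= 0 := maxP _.
have vP x : v x = m - f x /\ 0 <= m - f x \/ v x = 0 /\ m - f x <= 0 := maxP _.
have uvE x : `|f x - m| = u x + v x.
  have [fm|fm] := leP 0 (f x - m); [rewrite ger0_norm//|rewrite ltr0_norm//];
    by move: (uP x) (vP x); do 2!(case=> -[? ?]); lra.
under eq_bigr do rewrite uvE mulrDl.
rewrite big_split /=.
have mu_or0 (b : bool) x : (if b then mu x else 0) <= mu x by case: b.
have small (P Q : pred T) : (forall x, P x -> Q x) ->
    \sum_(x <- r | Q x) mu x <= \sum_(x <- r | ~~ Q x) mu x ->
    \sum_(x <- r | P x) mu x <= \sum_(x <- r | ~~ P x) mu x.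
  move=> PQ H; apply: (@le_trans _ _ (\sum_(x <- r | Q x) mu x)).
    rewrite [leLHS]big_mkcond [leRHS]big_mkcond; apply: ler_sum => x _.
    by case: ifP => [/PQ->//|_]; case: ifP.
  apply: (le_trans H).
  rewrite [leLHS]big_mkcond [leRHS]big_mkcond; apply: ler_sum => x _.
  have := PQ x; case: (P x) => [->//|_] /=; exact: mu_or0.
have Hu := @coarea_inequality R T r mu w K u K0 w0.
have Hv := @coarea_inequality R T r mu w K v K0 w0.
have lev (g : T -> R) (t : R) :
    \sum_(x <- r | t < g x) mu x <= \sum_(x <- r | ~~ (t < g x)) mu x ->
    \sum_(x <- r | t < g x) mu x <=
     K * \sum_(x <- r | t < g x) \sum_(y <- r | g y <= t) w x y.
  move=> H; have := iso (fun x => t < g x); rewrite min_l// => /le_trans; apply.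
  rewrite ler_wpM2l// ler_sum// => x _.
  by rewrite le_eqVlt; apply/predU1P; left; apply: eq_bigl => y; rewrite leNgt.
apply: (le_trans (lerD (Hu _ _) (Hv _ _))).
- by move=> x; rewrite /u le_max lexx orbT.
- move=> t t0; apply: lev; apply: small m1 => x.
  by rewrite /u lt_max [t < 0]ltNge t0 orbF; lra.
- by move=> x; rewrite /v le_max lexx orbT.
- move=> t t0; apply: lev; apply: small m2 => x.
  by rewrite /v lt_max [t < 0]ltNge t0 orbF; lra.
rewrite -mulrDr ler_wpM2l// -big_split ler_sum// => x _.
rewrite -big_split ler_sum// => y _ /=; rewrite -mulrDr ler_wpM2l//.
exact: posneg_parts_contract.
Qed.

(** * Balls, volumes and energies in a weighted graph *)

Local Open Scope classical_set_scope.

Lemma vol_seq (R : realType) (G : weighted_graph R) (s : seq G) :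
  uniq s -> vol [set` s] = \sum_(x <- s) vmeasure x.
Proof. by move=> us; rewrite /vol -fsbig_seq. Qed.

Lemma weight_nonadj (R : realType) (G : weighted_graph R) (x y : G) :
  ~~ adj y x -> weight x y = 0.
Proof.
by rewrite /adj weightC -leNgt => w0; apply/le_anti; rewrite w0 weight_ge0.
Qed.

Lemma boundary_weight_seq (R : realType) (G : weighted_graph R) (s t : seq G) :
  uniq s -> uniq t ->
  boundary_weight [set` s] [set` t] = \sum_(x <- s) \sum_(y <- t) weight x y.
Proof.
move=> us ut; rewrite /boundary_weight -fsbig_seq//; apply: eq_bigr => x _.
rewrite fsbig_mkcondr -fsbig_seq//; apply: eq_bigr => y _.
by case: ifPn => // /negP; rewrite inE /neighbours/= => /negP/weight_nonadj.
Qed.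

Lemma gball_natP (R : realType) (G : weighted_graph R) (x y : G) (n : nat) :
  gball x n%:R y <-> exists2 s, path_between x y s & (size s <= n)%N.
Proof.
split => [xy|[s xs sn]]; last first.
  rewrite /gball/=; apply: (@le_trans _ _ (size s)%:R%:E); last by rewrite lee_fin ler_nat.
  by apply: ereal_inf_lbound; exists s.
have /ereal_inf_lt [_ [s xs <-]] : (gdist x y < n.+1%:R%:E)%E.
  by apply: le_lt_trans xy _; rewrite lte_fin ltr_nat.
by rewrite lte_fin ltr_nat ltnS => sn; exists s.
Qed.

Lemma gball_center (R : realType) (G : weighted_graph R) (x : G) (n : nat) :
  gball x n%:R x.
Proof. by apply/gball_natP; exists [::]. Qed.

Lemma gball_triangle (R : realType) (G : weighted_graph R) (x y : G) (m n : nat) :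
  gball x m%:R y -> gball y n%:R `<=` gball x (m + n)%:R.
Proof.
move=> /gball_natP[s [ps ls] sm] z /gball_natP[t [pt lt] tn]; apply/gball_natP.
exists (s ++ t); last by rewrite size_cat leq_add.
by split; rewrite ?cat_path ?last_cat ls// ps.
Qed.

(** A sum with infinitely many nonzero terms is [0] by convention, whereas the
lower volume bound makes the volume of a ball positive. *)
Lemma finite_gball (R : realType) (G : weighted_graph R) (D C1 : R) (x : G) (r : R) :
  0 < C1 -> cond_volume G D C1 -> 1 <= r -> finite_set (gball x r).
Proof.
move=> C10 /(_ x r) volr r1; have /andP[+ _] := volr r1.
have [//|infB] := pselect (finite_set (gball x r)).
rewrite /vol fsbig_dflt ?leNgt ?mulr_gt0 ?invr_gt0 ?powR_gt0 ?(lt_le_trans _ r1)//.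
rewrite (_ : _ `&` _ = gball x r)//; apply/seteqP; split => [y []//|y By].
by split => //=; apply/eqP; rewrite gt_eqF// vmeasure_gt0.
Qed.

Lemma ball_poincare (R : realType) (G : weighted_graph R) (C2 : R) (x : G) (r : R)
    (f : G -> R) :
  0 <= C2 -> cond_isoperimetric G C2 -> 1 <= r -> finite_set (gball x r) ->
  gball x r x ->
  let B := fset_set (gball x r) in
  exists c, \sum_(y <- B) `|f y - c| * vmeasure y <=
    C2 * r * \sum_(y <- B) \sum_(z <- B) weight y z * `|f y - f z|.
Proof.
move=> C20 iso r1 finB xB B; apply: median_poincare.
- apply/eqP => B0; move: xB; rewrite -(fset_setK finB) /= -/B => xB.
  by have : x \in [::] by rewrite -B0.
- by rewrite mulr_ge0// (le_trans _ r1).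
- by move=> y; rewrite ltW// vmeasure_gt0.
- exact: weight_ge0.
move=> P; have uB (Q : pred G) : uniq [seq y <- B | Q y] by rewrite filter_uniq ?fset_uniq.
have BE : gball x r = [set` B] by rewrite fset_setK.
have sub : [set` [seq y <- B | P y]] `<=` gball x r.
  by rewrite BE => y /=; rewrite mem_filter => /andP[].
have DE : gball x r `\` [set` [seq y <- B | P y]] = [set` [seq y <- B | ~~ P y]].
  rewrite BE; apply/seteqP; split => y /=; rewrite !mem_filter.
    by move=> [yB /negP]; rewrite yB andbT => ->.
  by move=> /andP[/negbTE-> ->].
have := iso x r _ r1 sub; rewrite DE !vol_seq// boundary_weight_seq// !big_filter.
move=> /le_trans; apply; rewrite le_eqVlt; apply/predU1P; left.
by congr (_ * _); apply: eq_bigr => y _; rewrite big_filter.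
Qed.

Lemma weight_sum_le (R : realType) (G : weighted_graph R) (C0 : R) (s : seq G) (x : G) :
  1 <= C0 -> locally_finite G -> cond_bounded G C0 -> uniq s ->
  \sum_(y <- s) weight x y <= C0 ^+ 3 * vmeasure x.
Proof.
move=> C01 lf [mub wb degb] us; have C00 : 0 < C0 by apply: lt_le_trans C01.
have -> : \sum_(y <- s) weight x y = \sum_(y <- s | adj y x) weight x y.
  rewrite [RHS]big_mkcond; apply: eq_bigr => y _.
  by case: ifPn => // /weight_nonadj.
apply: (@le_trans _ _ (\sum_(y <- s | adj y x) C0)).
  by apply: ler_sum => y yx; rewrite weightC; have /andP[] := wb _ _ yx.
rewrite big_const_seq iter_addr_0 -mulr_natr.
apply: (@le_trans _ _ (C0 * C0)).
  rewrite ler_wpM2l ?(ltW C00)// (le_trans _ (degb x))// ler_nat /deg -size_filter.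
  apply: uniq_leq_size; first exact: filter_uniq.
  by move=> y; rewrite mem_filter => /andP[yx _]; rewrite in_fset_set// inE.
rewrite !exprS expr0 mulr1 -!mulrA ler_wpM2l ?(ltW C00)//.
rewrite ler_peMr ?(ltW C00)// mulrC -ler_pdivrMr// mul1r.
by have /andP[] := mub x.
Qed.

Lemma energy_ge_finite (R : realType) (G : weighted_graph R) (p : R) (u : G -> R)
    (B : {fset G}) :
  ((2^-1 * \sum_(x <- B) \sum_(y <- B) weight x y * `|u y - u x| `^ p)%:E
    <= energy p u)%E.
Proof.
rewrite /energy EFinM lee_pmul2l ?ltr_fin ?lte_fin ?invr_gt0//.
apply: esum_ge; exists ([set` B] `*` [set` B]).
  by split => //; apply: finite_setX.
rewrite -(@pair_fsbig _ _ _ _ _ _ _ (fun x y => (weight x y * `|u y - u x| `^ p)%:E))//.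
rewrite -fsbig_seq// -sumEFin le_eqVlt; apply/predU1P; left.
by apply: eq_bigr => x _; rewrite -fsbig_seq// sumEFin.
Qed.

(** If [a > lam], then [a ^ (1 - p) <= lam ^ (1 - p)] since [p >= 1].  Summed
against weights and with [lam] well chosen, this does the work of Hoelder's
inequality. *)
Lemma young_split (R : realType) (p a lam : R) :
  1 <= p -> 0 <= a -> 0 < lam -> a <= lam + lam `^ (1 - p) * a `^ p.
Proof.
move=> p1 a0 lam0; have [al|la] := leP a lam.
  by rewrite (le_trans al)// lerDl mulr_ge0// powR_ge0.
rewrite (@le_trans _ _ (lam `^ (1 - p) * a `^ p))// ?lerDr ?(ltW lam0)//.
have ag0 : 0 < a by exact: lt_trans la.
have -> : a `^ p = a * a `^ (p - 1).
  by rewrite -{2}(powRr1 a0) -powRD ?(gt_eqF ag0) ?implybT//; congr (_ `^ _); ring.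
rewrite -[1 - p]opprB powRN mulrCA ler_peMr// ler_pdivlMl ?powR_gt0// mulr1.
by rewrite ge0_ler_powR ?subr_ge0 ?nnegrE// ltW.
Qed.

(** * Oscillation on a ball and dyadic telescoping *)

(** Splitting each gradient with [young_split] at [lam = s * r `^ (- (D / p))]
leaves [lam] times the total weight of the ball, of order [r `^ D], and
[lam `^ (1 - p)] times the energy.  The exponent [- D / p] is the one for which
both contributions scale like [r `^ (D + (1 - D / p))] once multiplied by [r]. *)
Lemma ball_oscillation (R : realType) (G : weighted_graph R)
    (p D C0 C1 C2 : R) (f : G -> R) (E s : R) (x : G) (n : nat) :
  1 <= p -> 1 <= C0 -> 1 <= C1 -> 1 <= C2 ->
  locally_finite G -> cond_bounded G C0 -> cond_volume G D C1 ->
  cond_isoperimetric G C2 ->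
  0 <= E -> (energy p f <= E%:E)%E -> 0 < s -> (0 < n)%N ->
  exists c, \sum_(y <- fset_set (gball x n%:R)) `|f y - c| * vmeasure y <=
    2 * C0 ^+ 3 * C1 * C2 * (s + s `^ (1 - p) * E) * n%:R `^ (D + (1 - D / p)).
Proof.
move=> p1 hC0 hC1 hC2 lf bd vl iso E0 fE s0 n0.
have rho1 : 1 <= n%:R :> R by rewrite ler1n.
set rho : R := n%:R in rho1 *; have rho0 : 0 < rho by apply: lt_le_trans rho1.
have p0 : 0 < p by apply: lt_le_trans p1.
have finB : finite_set (gball x rho).
  by apply: (finite_gball _ _ vl) => //; apply: lt_le_trans hC1.
have xB : gball x rho x := gball_center x n.
have C20 : 0 <= C2 by apply: le_trans hC2.
have [c] := ball_poincare f C20 iso rho1 finB xB.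
set B := fset_set _ => Hc; exists c; apply: (le_trans Hc).
pose lam := s * rho `^ (- (D / p)).
have lam0 : 0 < lam by rewrite mulr_gt0 ?powR_gt0.
pose W := \sum_(y <- B) \sum_(z <- B) weight y z.
pose F := \sum_(y <- B) \sum_(z <- B) weight y z * `|f z - f y| `^ p.
have WF : \sum_(y <- B) \sum_(z <- B) weight y z * `|f y - f z| <=
    lam * W + lam `^ (1 - p) * F.
  rewrite !mulr_sumr -big_split ler_sum// => y _.
  rewrite /= !mulr_sumr -big_split ler_sum// => z _ /=.
  rewrite distrC mulrCA (mulrC lam) -mulrDr ler_wpM2l ?weight_ge0//.
  exact: young_split.
have hW : W <= C0 ^+ 3 * (C1 * rho `^ D).
  have /andP[_] := vl x rho rho1; rewrite -(fset_setK finB) vol_seq ?fset_uniq//.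
  rewrite -/B => hB; apply: (@le_trans _ _ (C0 ^+ 3 * \sum_(y <- B) vmeasure y)).
    rewrite mulr_sumr ler_sum// => y _; apply: weight_sum_le => //.
    exact: fset_uniq.
  by rewrite ler_wpM2l// exprn_ge0// (le_trans _ hC0).
have hF : F <= 2 * E.
  have := le_trans (energy_ge_finite p f B) fE.
  by rewrite lee_fin -/F ler_pdivrMl.
apply: (@le_trans _ _ (C2 * rho * (lam * (C0 ^+ 3 * (C1 * rho `^ D)) +
    lam `^ (1 - p) * (2 * E)))).
  rewrite ler_wpM2l ?mulr_ge0 ?(ltW rho0)//; apply: (le_trans WF).
  by rewrite lerD// ler_wpM2l ?powR_ge0// ltW.
have rhoN : (rho == 0) = false by rewrite gt_eqF.
set t := rho `^ (D + (1 - D / p)).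
have t1 : rho * lam * rho `^ D = s * t.
  rewrite /t /lam -{1}(powRr1 (ltW rho0)) mulrCA -!mulrA -!powRD ?rhoN ?implybT//.
  by congr (_ * _ `^ _); ring.
have t2 : rho * lam `^ (1 - p) = s `^ (1 - p) * t.
  rewrite /t /lam powRM ?powR_ge0 ?(ltW s0)// mulrCA -powRrM.
  rewrite -{1}(powRr1 (ltW rho0)) -!powRD ?rhoN ?implybT//.
  by congr (_ * _ `^ _); field; rewrite gt_eqF.
have -> : C2 * rho * (lam * (C0 ^+ 3 * (C1 * rho `^ D)) + lam `^ (1 - p) * (2 * E)) =
    C2 * (C0 ^+ 3 * C1 * (rho * lam * rho `^ D) + 2 * E * (rho * lam `^ (1 - p))).
  by ring.
rewrite t1 t2.
have t0 : 0 <= t by exact: powR_ge0.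
have C031 : 1 <= C0 ^+ 3 * C1.
  by rewrite mulr_ege1// exprn_ege1.
have -> : 2 * C0 ^+ 3 * C1 * C2 * (s + s `^ (1 - p) * E) * t =
  C2 * (2 * (C0 ^+ 3 * C1) * (s * t) + 2 * (C0 ^+ 3 * C1) * (E * (s `^ (1 - p) * t))).
  by ring.
rewrite ler_wpM2l// lerD//.
  by rewrite ler_wpM2r ?mulr_ge0 ?(ltW s0)// ler_peMl//; lra.
rewrite -mulrA ler_wpM2r ?mulr_ge0 ?powR_ge0//; lra.
Qed.

Lemma center_diff_le (R : realDomainType) (T : eqType) (s t : seq T)
    (mu f : T -> R) (a c : R) :
  uniq s -> uniq t -> {subset s <= t} -> (forall x, 0 <= mu x) ->
  `|a - c| * \sum_(x <- s) mu x <=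
  \sum_(x <- s) `|f x - a| * mu x + \sum_(x <- t) `|f x - c| * mu x.
Proof.
move=> us ut st mu0.
apply: (@le_trans _ _ (\sum_(x <- s) `|f x - a| * mu x + \sum_(x <- s) `|f x - c| * mu x)).
  rewrite mulr_sumr -big_split ler_sum// => x _ /=.
  rewrite -mulrDl ler_wpM2r// (distrC (f x) a).
  by have := ler_normD (a - f x) (f x - c); rewrite addrA subrK.
rewrite lerD2l.
have -> : \sum_(x <- s) `|f x - c| * mu x = \sum_(x <- t | x \in s) `|f x - c| * mu x.
  rewrite -[RHS]big_filter; apply: perm_big; apply: uniq_perm => //.
    exact: filter_uniq.
  by move=> x; rewrite mem_filter; case: (boolP (x \in s)) => //= /st->.
rewrite [leLHS]big_mkcond ler_sum// => x _; case: ifP => // _.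
by rewrite mulr_ge0.
Qed.

(** With [q := 2 `^ al], the factor [q / (q - 1)] sums the geometric series of
ratio [q], the next factor compares two consecutive centers, [3] counts the
links of a chain joining two points, and [q ^+ 2] comes from rounding their
distance up to a power of 2 and from doubling that radius once more. *)
Definition telescope_const (R : realType) (C0 C1 D al : R) : R :=
  3 * (2 `^ al / (2 `^ al - 1)) * (C0 + C1 * (1 + 2 `^ (D + al))) * (2 `^ al) ^+ 2.

Section Telescope.
Context (R : realType) (G : weighted_graph R) (C0 C1 D al M : R) (f : G -> R).
Hypotheses (hC0 : 1 <= C0) (hC1 : 1 <= C1) (al0 : 0 < al) (M0 : 0 <= M).
Hypotheses (bd : cond_bounded G C0) (vl : cond_volume G D C1).

(* [c] is a center of [f] on the ball of radius [n] around [x]. *)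
Let avg (x : G) (n : nat) (c : R) :=
  \sum_(y <- fset_set (gball x n%:R)) `|f y - c| * vmeasure y <=
  M * n%:R `^ (D + al).

Hypothesis avgP : forall x n, (0 < n)%N -> exists c, avg x n c.

Let C10 : 0 < C1. Proof. exact: lt_le_trans hC1. Qed.
Let L := C0 + C1 * (1 + 2 `^ (D + al)).
Let q := 2 `^ al.
Let Q := q / (q - 1).

Let q1 : 1 < q.
Proof.
by rewrite /q /powR pnatr_eq0/= expR_gt1 mulr_gt0// ln_gt0// ltr1n.
Qed.

Let L0 : 0 <= L.
Proof. by rewrite addr_ge0 ?(le_trans _ hC0) ?mulr_ge0 ?(ltW C10) ?addr_ge0 ?powR_ge0. Qed.

Let Q1 : 1 <= Q.
Proof. by have := q1; rewrite /Q ler_pdivlMr ?subr_gt0//; lra. Qed.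

Let finB (x : G) n : (0 < n)%N -> finite_set (gball x n%:R).
Proof. by move=> n0; apply: (finite_gball _ C10 vl); rewrite ler1n. Qed.

(** The ball around [y] lies in the one around [x], and its volume is at least
[C1^-1 * n `^ D]: this cancels the factor [n `^ D] in the two oscillations. *)
Lemma center_step (x y : G) (n : nat) (a c : R) :
  (0 < n)%N -> gball x n%:R y -> avg y n a -> avg x (n + n) c ->
  `|a - c| <= L * M * n%:R `^ al.
Proof.
move=> n0 xy ya xc; have nn0 : (0 < n + n)%N by rewrite addn_gt0 n0.
have sub : {subset fset_set (gball y n%:R) <= fset_set (gball x (n + n)%:R)}.
  move=> z; rewrite !in_fset_set//; try exact: finB.
  by rewrite !inE; apply: gball_triangle.
have := @center_diff_le R G _ _ (@vmeasure R G) f a c (fset_uniq _) (fset_uniq _) sub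
  (fun x => ltW (vmeasure_gt0 x)).
move=> /le_trans/(_ (lerD ya xc)).
have rho1 : 1 <= n%:R :> R by rewrite ler1n.
have /andP[+ _] := vl y rho1.
rewrite -(fset_setK (finB y n0)) vol_seq ?fset_uniq// fset_setK; last exact: finB.
move=> hv H.
have {H}: `|a - c| * (C1^-1 * n%:R `^ D) <= M * n%:R `^ (D + al) + M * (n + n)%:R `^ (D + al).
  by apply: le_trans H; rewrite ler_wpM2l.
have rho0 : 0 < n%:R :> R by rewrite ltr0n.
have -> : (n + n)%:R = 2 * n%:R :> R by rewrite natrD; ring.
rewrite powRM ?(ltW rho0)// (powRD (x := n%:R)) ?(gt_eqF rho0) ?implybT//.
set t := n%:R `^ D; have t0 : 0 < t by rewrite powR_gt0.
set u := n%:R `^ al; have u0 : 0 <= u by rewrite powR_ge0.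
have -> : M * (t * u) + M * (2 `^ (D + al) * (t * u)) =
  (C1 * (1 + 2 `^ (D + al)) * M * u) * (C1^-1 * t).
  by field; rewrite gt_eqF.
rewrite ler_pM2r ?mulr_gt0 ?invr_gt0// => /le_trans; apply.
by rewrite ler_wpM2r// ler_wpM2r// /L lerDr (le_trans _ hC0).
Qed.

Lemma center_singleton (x : G) (c : R) : avg x 1 c -> `|f x - c| <= L * M.
Proof.
rewrite /avg powR1 mulr1 => H; have [/(_ x)/andP[m1 _] _ _] := bd.
have C00 : 0 < C0 by apply: lt_le_trans hC0.
have : `|f x - c| * C0^-1 <= M.
  apply: le_trans H; rewrite (big_fsetD1 x)/=; last first.
    by rewrite in_fset_set ?inE; [exact: gball_center|exact: finB].
  rewrite -[leLHS]addr0 lerD ?ler_wpM2l// sumr_ge0// => y _.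
  by rewrite mulr_ge0// ltW// vmeasure_gt0.
rewrite ler_pdivrMr// => /le_trans; apply; rewrite mulrC ler_wpM2r// /L lerDl.
by rewrite mulr_ge0 ?(ltW C10)// addr_ge0// powR_ge0.
Qed.

Let pow2 j : (2 ^ j)%:R `^ al = q ^+ j.
Proof. by rewrite natrX -powR_mulrn// -powRrM mulrC powRrM powR_mulrn ?powR_ge0. Qed.

(** The induction closes because [Q = q / (q - 1)] satisfies [Q + 1 <= Q * q]: a
geometric sum of ratio [q > 1] is controlled by its last term. *)
Lemma center_telescope j (x : G) :
  exists2 c, avg x (2 ^ j) c & `|f x - c| <= Q * (L * M) * q ^+ j.
Proof.
have LM0 : 0 <= L * M by rewrite mulr_ge0.
have qgt1 := q1; have Qge1 := Q1; have q0 : 0 <= q := le_trans ler01 (ltW q1).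
elim: j => [|j [c xc fc]].
  have [c xc] := avgP x (ltn0Sn 0); exists c => //.
  rewrite expr0 mulr1 (le_trans (center_singleton xc))// ler_peMl//.
have [c' xc'] := avgP x (expn_gt0 2 j.+1); exists c' => //.
rewrite expnS mul2n -addnn in xc'.
have step := center_step (expn_gt0 2 j) (gball_center _ _) xc xc'.
have := ler_normD (f x - c) (c - c'); rewrite addrA subrK => /le_trans; apply.
apply: (le_trans (lerD fc step)); rewrite pow2.
have -> : Q * (L * M) * q ^+ j + L * M * q ^+ j = (Q + 1) * (L * M * q ^+ j) by ring.
rewrite exprS [leRHS](_ : _ = (Q * q) * (L * M * q ^+ j)); last by ring.
rewrite ler_wpM2r ?mulr_ge0 ?exprn_ge0//.
have -> : Q + 1 = Q * q - (Q * (q - 1) - 1) by ring.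
by rewrite /Q divfK ?subr_eq0 ?gt_eqF//; lra.
Qed.

(** The chain goes up from [y] to its ball of radius [2 ^ J >= n], into the ball
of radius [2 ^ J.+1] around [x], which contains it, and down to [x]. *)
Lemma telescope_diff (x y : G) (n : nat) : (0 < n)%N -> gball x n%:R y ->
  `|f x - f y| <= telescope_const C0 C1 D al * M * n%:R `^ al.
Proof.
move=> n0 xy; pose J := (trunc_log 2 n).+1.
have /andP[nJ Jn] := trunc_log_bounds (isT : (1 < 2)%N) n0.
have xyJ : gball x (2 ^ J)%:R y.
  have /gball_natP[s ps sn] := xy; apply/gball_natP; exists s => //.
  exact: leq_trans sn (ltnW Jn).
have [c yc fyc] := center_telescope J y.
have [d xd fxd] := center_telescope J.+1 x.
rewrite expnS mul2n -addnn in xd.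
have step := center_step (expn_gt0 2 J) xyJ yc xd.
have LM0 : 0 <= L * M by rewrite mulr_ge0.
have qgt1 := q1; have Qge1 := Q1; have q0 : 0 <= q := le_trans ler01 (ltW q1).
have qJ0 : 0 <= q ^+ J by rewrite exprn_ge0//; lra.
have -> : f x - f y = (f x - d) - ((f y - c) + (c - d)) by ring.
apply: (le_trans (ler_normB _ _)); apply: (le_trans (lerD fxd (ler_normD _ _))).
apply: (le_trans (lerD (lexx _) (lerD fyc step))); rewrite pow2 exprS.
apply: (@le_trans _ _ (3 * (Q * q) * (L * M * q ^+ J))).
  rewrite [leLHS](_ : _ = (Q * q + Q + 1) * (L * M * q ^+ J)); last by ring.
  rewrite ler_wpM2r ?mulr_ge0//.
  have : 0 <= (Q - 1) * (q - 1) by rewrite mulr_ge0//; lra.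
  have -> : (Q - 1) * (q - 1) = Q * q - Q - q + 1 by ring.
  by lra.
have : q ^+ J <= q * n%:R `^ al.
  rewrite -pow2 /q -powRM// ge0_ler_powR ?nnegrE ?(ltW al0)//.
  by rewrite -natrM ler_nat /J expnS leq_mul2l nJ.
have P0 : 0 <= 3 * (Q * q) * (L * M) by do 3!apply: mulr_ge0 => //; lra.
move=> /(ler_wpM2l P0) H; rewrite [leLHS]mulrA; apply: (le_trans H).
by rewrite le_eqVlt; apply/predU1P; left; rewrite /telescope_const -/q -/Q -/L; ring.
Qed.

End Telescope.

(** * The Morrey inequality and the capacitary radius *)

Lemma telescope_const_gt0 (R : realType) (C0 C1 D al : R) :
  0 < C0 -> 0 <= C1 -> 0 < al -> 0 < telescope_const C0 C1 D al.
Proof.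
move=> C00 C10 al0; have q1 : 1 < 2 `^ al :> R.
  by rewrite /powR pnatr_eq0/= expR_gt1 mulr_gt0// ln_gt0// ltr1n.
have q0 : 0 < 2 `^ al :> R by exact: lt_trans q1.
rewrite /telescope_const !mulr_gt0 ?exprn_gt0 ?invr_gt0 ?subr_gt0//.
by rewrite ltr_wpDr// mulr_ge0// addr_ge0// powR_ge0.
Qed.

(** The bound of [telescope_diff] holds for every [s > 0]; [s] is chosen below
so that its first term absorbs half of the oscillation [d]. *)
Lemma morrey_inequality (R : realType) (p D C0 C1 C2 : R) :
  1 < D -> 1 <= C0 -> 1 <= C1 -> 1 <= C2 -> D < p ->
  exists2 C : R, 0 < C &
    forall G : weighted_graph R,
      locally_finite G -> cond_bounded G C0 -> cond_volume G D C1 ->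
      cond_isoperimetric G C2 ->
      forall (f : G -> R) (E : R) (x y : G) (n : nat),
        0 <= E -> (energy p f <= E%:E)%E -> (0 < n)%N -> gball x n%:R y ->
        `|f x - f y| `^ p <= C * n%:R `^ (p - D) * E.
Proof.
move=> hD hC0 hC1 hC2 hp.
have p1 : 1 < p by exact: lt_trans hp.
have p0 : 0 < p by exact: lt_trans p1.
pose al := 1 - D / p.
have al0 : 0 < al by rewrite subr_gt0 ltr_pdivrMr// mul1r.
have alp : al * p = p - D by rewrite /al mulrBl mul1r divfK// gt_eqF.
pose K := 2 * C0 ^+ 3 * C1 * C2.
have K0 : 0 < K by rewrite /K !mulr_gt0 ?exprn_gt0//; lra.
pose H := telescope_const C0 C1 D al * K.
have H0 : 0 < H by rewrite /H mulr_gt0// telescope_const_gt0//; lra.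
exists ((2 * H) `^ p); first by apply: powR_gt0; apply: mulr_gt0.
move=> G lf bd vl iso f E x y n E0 fE n0 xy.
set d := `|f x - f y|.
have [d0|d0] := leP d 0.
  have -> : d = 0 by apply/le_anti; rewrite d0 normr_ge0.
  by rewrite powR0 ?gt_eqF// !mulr_ge0// powR_ge0.
have nR0 : 0 < n%:R :> R by rewrite ltr0n.
pose h := 2 * H * n%:R `^ al.
have h0 : 0 < h by apply: mulr_gt0; [apply: mulr_gt0|apply: powR_gt0].
(* [H * n `^ al * s = d / 2] *)
pose s := d / h; have s0 : 0 < s by rewrite divr_gt0.
have M0 : 0 <= K * (s + s `^ (1 - p) * E).
  apply: mulr_ge0; first exact: ltW.
  by apply: addr_ge0; [exact: ltW|rewrite mulr_ge0// powR_ge0].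
have osc z m : (0 < m)%N -> exists c,
    \sum_(v <- fset_set (gball (z : G) m%:R)) `|f v - c| * vmeasure v <=
    K * (s + s `^ (1 - p) * E) * m%:R `^ (D + al).
  by move=> m0; apply: (ball_oscillation _ (ltW p1) hC0 hC1 hC2 lf bd vl iso).
have := telescope_diff hC0 hC1 al0 M0 bd vl osc n0 xy.
rewrite -/d => hd.
have {}hd : d <= h / 2 * (s + s `^ (1 - p) * E).
  by apply: le_trans hd _; rewrite le_eqVlt; apply/predU1P; left; rewrite /h /H; field.
have hs : h * s = d by rewrite /s mulrC divfK// gt_eqF.
have {}hd : d <= h * s `^ (1 - p) * E.
  have : h / 2 * (s + s `^ (1 - p) * E) = (h * s) / 2 + (h * s `^ (1 - p) * E) / 2.
    by field.
  by rewrite hs; lra.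
have -> : (2 * H) `^ p * n%:R `^ (p - D) = h `^ p.
  have H2 : 0 <= 2 * H by rewrite ltW// mulr_gt0.
  by rewrite -alp powRrM -powRM ?powR_ge0.
have sp : s `^ (1 - p) = h `^ (p - 1) * d `^ (1 - p).
  rewrite /s powRM ?invr_ge0 ?ltW// mulrC; congr (_ * _).
  by rewrite -powR_inv1 ?ltW// -powRrM; congr (_ `^ _); ring.
have hE : h * h `^ (p - 1) = h `^ p.
  rewrite -{1}(powRr1 (ltW h0)) -powRD ?(gt_eqF h0) ?implybT//.
  by congr (_ `^ _); ring.
have dE : d * d `^ (p - 1) = d `^ p.
  rewrite -{1}(powRr1 (ltW d0)) -powRD ?(gt_eqF d0) ?implybT//.
  by congr (_ `^ _); ring.
rewrite -dE -ler_pdivlMr ?powR_gt0// -powRN opprB (le_trans hd)// sp -hE.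
by rewrite le_eqVlt; apply/predU1P; left; ring.
Qed.

(** [n] is the length of a shortest path leaving [Omega]; such a path exists as
the graph is connected and infinite while [Omega] is finite. *)
Lemma exit_distance (R : realType) (G : weighted_graph R) (Omega : {fset G}) (x : G) :
  graph_connected G -> x \in Omega ->
  exists (n : nat) (y : G), [/\ (0 < n)%N, y \notin Omega, gball x n%:R y &
    (n%:R%:E <= inner_radius Omega)%E].
Proof.
move=> conn xO.
pose exits n := `[< exists2 y, y \notin Omega & gball x n%:R y >].
have ex : exists n, exits n.
  have [y yO] : exists y, y \notin Omega.
    apply: contrapT => noy; apply: (@vertex_infinite _ G).
    apply: sub_finite_set (finite_fset Omega) => y _ /=.
    by apply: contrapT => /negP yO; apply: noy; exists y.
  have [s xs] := conn x y; exists (size s); apply/asboolP; exists y => //.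
  by apply/gball_natP; exists s.
case: (ex_minnP ex) => n /asboolP[y yO xy] nmin; exists n, y; split => //.
  rewrite lt0n; apply/negP => /eqP n0; move: xy yO; rewrite n0.
  by move=> /gball_natP[[|//] [_ /= <-]]; rewrite xO.
apply: (@le_trans _ _ (dist_compl x Omega)); last first.
  by apply: ereal_sup_ubound; exists x.
apply: le_ereal_inf_tmp => _ [z /= zO <-]; apply: le_ereal_inf_tmp => _ [s xs <-].
rewrite lee_fin ler_nat; apply: nmin; apply/asboolP; exists z => //.
by apply/gball_natP; exists s.
Qed.

Theorem theorem3p4 (R : realType) (p D C0 C1 C2 : R)
    (hD : 1 < D) (hC0 : 1 <= C0) (hC1 : 1 <= C1) (hC2 : 1 <= C2) (hp : D < p) :
  exists2 C : R, 0 < C &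
    forall G : weighted_graph R,
      graph_connected G -> locally_finite G ->
      cond_bounded G C0 -> cond_volume G D C1 -> cond_isoperimetric G C2 ->
      forall Omega : {fset G}, Omega != fset0 ->
        (capacitary_radius p Omega <=
         C%:E * poweR (inner_radius Omega) (p - D))%E.
Proof.
have [C C0' morrey] := morrey_inequality hD hC0 hC1 hC2 hp; exists C => //.
move=> G conn lf bd vl iso Omega _.
have main x : x \in Omega ->
    ((capacity p x Omega)^-1 <= C%:E * poweR (inner_radius Omega) (p - D))%E.
  move=> xO; have [n [y [n0 yO xy nr]]] := exit_distance conn xO.
  have nR0 : 0 < n%:R :> R by rewrite ltr0n.
  set b := C * n%:R `^ (p - D); have b0 : 0 < b by apply: mulr_gt0 => //; apply: powR_gt0.
  have bcap : ((b^-1)%:E <= capacity p x Omega)%E.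
    apply: le_ereal_inf_tmp => _ [phi [/= phi0 phix] <-].
    have : (0 <= energy p phi)%E.
      rewrite /energy mule_ge0 ?lee_fin// esum_ge0// => z _.
      by rewrite lee_fin mulr_ge0 ?weight_ge0 ?powR_ge0.
    case e : (energy p phi) => [E| |//]; last by move=> _; exact: leey.
    rewrite lee_fin => E0.
    have := morrey G lf bd vl iso phi E x y n E0 _ n0 xy.
    rewrite phix (phi0 y yO) subr0 normr1 powR1 e lexx => /(_ isT).
    by rewrite lee_fin -/b -ler_pdivrMl// mulr1.
  have cap0 : (0 <= capacity p x Omega)%E.
    by apply: le_trans bcap; rewrite lee_fin invr_ge0 ltW.
  apply: (@le_trans _ _ b%:E).
    rewrite inve_ple ?inE//; last by rewrite lee_fin ltW.
    by rewrite inver gt_eqF.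
  rewrite /b EFinM lee_pmul2l ?lte_fin// -poweR_EFin.
  apply: gt0_ler_poweR => //; first by rewrite subr_ge0 ltW.
    by rewrite in_itv/= lee_fin ler0n leey.
  by rewrite in_itv/= leey andbT; apply: le_trans nr; rewrite lee_fin ler0n.
rewrite /capacitary_radius big_seq.
apply: (big_ind (fun c => c <= C%:E * poweR (inner_radius Omega) (p - D))%E) => //.
- exact: leNye.
- by move=> a b ha hb; rewrite ge_max ha hb.
Qed.
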